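(* Let $U$ be a finite set of user types, $\pi$ a probability distribution on $U$, $M$ a finite set of movies, $p_{m,u} \in [0,1]$ for each $m \in M$, $u \in U$, and $\theta_u$ a positive integer for each $u \in U$. For a finite sequence $S = s_1 s_2 \dots s_{|S|}$ of movies define $$f(S) = \sum_{u \in U} \pi_u \left(1 - \prod_{j=1}^{\min\{\theta_u, |S|\}} (1 - p_{s_j,u})\right).$$ Then $f$ is ordered-submodular. Consequently, for every integer $k \ge 1$, the length-$k$ list $A_k$ produced by the greedy algorithm satisfies $f(A_k) \ge \frac12 \max\{ f(S) : S \text{ a sequence of } k \text{ movies}\}$.
   Context: For sequences $A, B$, $A\|B$ denotes concatenation and $A\|s$ denotes $A$ with element $s$ appended; $\emptyset$ is the empty sequence. A function $f$ on finite sequences of elements of $M$ is ordered-submodular if for all sequences $A$, $B$ and all elements $s, \bar s \in M$: $f(A\|s) - f(A) \ge f(A\|s\|B) - f(A\|\bar s\|B)$. The greedy algorithm: $A_0 = \emptyset$; for $\ell = 1,\dots,k$, $A_\ell = A_{\ell-1}\|a$ where $a \in M$ maximizes $f(A_{\ell-1}\|a)$ (ties broken arbitrarily). Interpretation: $f(S)$ is the probability that a random user of type drawn from $\pi$, who inspects only the first $\theta_u$ items, likes at least one inspected item, where movie $m$ independently pleases type $u$ with probability $p_{m,u}$. *)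

(* Defs.v *)
From mathcomp Require Import all_boot all_order all_algebra.

Set Implicit Arguments.
Unset Strict Implicit.
Unset Printing Implicit Defensive.

Import Order.TTheory GRing.Theory Num.Theory.
Local Open Scope ring_scope.

Definition ordered_submodular (R : realFieldType) (M : Type)
    (f : seq M -> R) : Prop :=
  forall (A B : seq M) (s sbar : M),
    f (rcons A s) - f A >= f (rcons A s ++ B) - f (rcons A sbar ++ B).

(* [greedy f k A]: A is a possible output A_k of k greedy steps; being a
   relation, it covers every way of breaking ties. *)
Inductive greedy (R : realFieldType) (M : Type) (f : seq M -> R) :
    nat -> seq M -> Prop :=
| greedy0 : greedy f 0 [::]
| greedyS (l : nat) (A : seq M) (a : M) :
    greedy f l A ->
    (forall b : M, f (rcons A b) <= f (rcons A a)) ->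
    greedy f l.+1 (rcons A a).

(* [take (theta u) S] lists exactly the s_j with
   1 <= j <= min(theta_u, |S|). *)
Definition like_prob (R : realFieldType) (U M : finType)
    (pi : U -> R) (p : M -> U -> R) (theta : U -> nat) (S : seq M) : R :=
  \sum_(u : U) pi u * (1 - \prod_(s <- take (theta u) S) (1 - p s u)).

(* The seed 0 does not affect the maximum as long as f is nonnegative on
   sequences of length k and there is at least one of them. *)
Definition max_value (R : realFieldType) (M : finType) (f : seq M -> R)
    (k : nat) : R :=
  \big[Num.max/0]_(S : k.-tuple M) f S.

(* Main.v *)
(** Writing O = o_1 ... o_k for any competitor, replace the prefix of O by the
    greedy prefix one element at a time.  By ordered submodularity, exchanging
    o_l for the greedy a_l loses at most f(A_{l-1} o_l) - f(A_{l-1}), hence at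
    most the greedy increment f(A_l) - f(A_{l-1}); these increments telescope,
    so f(O) - f(A_k) <= f(A_k) - f([::]). *)
Require Import Defs.
From mathcomp Require Import all_boot all_order all_algebra.
From mathcomp Require Import lra.

Import Order.TTheory GRing.Theory Num.Theory.
Local Open Scope ring_scope.

Lemma prod_1B_itv01 {R : realFieldType} {M : Type} (q : M -> R) (S : seq M) :
  (forall m, 0 <= q m <= 1) -> 0 <= \prod_(s <- S) (1 - q s) <= 1.
Proof.
move=> q01; rewrite prodr_ge0 ?prodr_ile1 // => s _.
  by have := q01 s; lra.
by have := q01 s; lra.
Qed.

(** The case of one user type with patience [t]; [like_prob] is a nonnegative combination of such
    functions. If [t <= size A], nothing after [A] is inspected and all four values agree. *)
Lemma like_one_ordered_submodular {R : realFieldType} {M : Type} (q : M -> R)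
    (t : nat) :
  (forall m, 0 <= q m <= 1) ->
  ordered_submodular (fun S => 1 - \prod_(s <- take t S) (1 - q s)).
Proof.
move=> q01 A B s s' /=; rewrite -!cats1 -!catA !take_cat.
case: ltnP => [_|leAt]; first by rewrite !subrr.
rewrite (take_oversize leAt).
case: (t - size A)%N => [|r] /=; first by rewrite !cats0 !subrr.
rewrite subn1 !big_cat /= !big_cons !big_nil.
have /andP[P0 _] := prod_1B_itv01 q A q01.
have /andP[Q0 Q1] := prod_1B_itv01 q (take r B) q01.
move: P0 Q0 Q1; set P := \prod_(_ <- A) _; set Q := \prod_(_ <- _) _.
move=> P0 Q0 Q1.
have /andP[s0 _] := q01 s; have /andP[s'0 _] := q01 s'.
(* The gain is [P * q s] and the exchange difference [P * Q * (q s - q s')]; the former minus the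
   latter is exactly the sum of [h1] and [h2]. *)
have h1 : 0 <= P * (q s * (1 - Q)) by rewrite !mulr_ge0 // subr_ge0.
have h2 : 0 <= P * (q s' * Q) by rewrite !mulr_ge0.
lra.
Qed.

(** The suffix [B] is arbitrary so that, in the induction, it can absorb the last element of [S]. *)
Lemma greedy_exchange {R : realFieldType} {M : Type} (f : seq M -> R)
    (l : nat) (A : seq M) :
  ordered_submodular f -> greedy f l A ->
  forall S B : seq M, size S = l -> f (S ++ B) - f (A ++ B) <= f A - f [::].
Proof.
move=> fsub; elim=> {l A} [|l A a _ IH amax] S B.
  by move/size0nil ->; rewrite !subrr.
case/lastP: S => // S o; rewrite size_rcons => -[sizeS].
have := IH S (o :: B) sizeS; have := fsub A B o a; have := amax o.
by rewrite !cat_rcons; lra.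
Qed.

Theorem theorem1 (R : realFieldType) (U M : finType)
    (pi : U -> R) (p : M -> U -> R) (theta : U -> nat)
    (pi_ge0 : forall u : U, 0 <= pi u)
    (pi_sum1 : \sum_(u : U) pi u = 1)
    (p01 : forall (m : M) (u : U), 0 <= p m u <= 1)
    (theta_gt0 : forall u : U, (0 < theta u)%N) :
  ordered_submodular (like_prob pi p theta) /\
  (forall (k : nat) (A : seq M),
     (1 <= k)%N ->
     greedy (like_prob pi p theta) k A ->
     like_prob pi p theta A >= 2^-1 * max_value (like_prob pi p theta) k).
Proof.
have fsub : ordered_submodular (like_prob pi p theta).
  move=> A B s s'; rewrite /like_prob -!sumrB; apply: ler_sum => u _.
  rewrite -!mulrBr ler_wpM2l //.
  exact: (like_one_ordered_submodular (p^~ u)).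
split=> // k A _ grA.
have f_ge0 S : 0 <= like_prob pi p theta S.
  apply: sumr_ge0 => u _; rewrite mulr_ge0 // subr_ge0.
  by have /andP[] := prod_1B_itv01 (p^~ u) (take (theta u) S) (p01^~ u).
suff : max_value (like_prob pi p theta) k <= 2 * like_prob pi p theta A by lra.
(* The first goal bounds the seed 0 of the maximum. *)
apply: bigmax_le => [|S _]; first by rewrite mulr_ge0.
have := greedy_exchange _ _ _ fsub grA S [::] (size_tuple S).
by have := f_ge0 [::]; rewrite !cats0; lra.
Qed.
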